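(* Assume that for every positive integer $m$ the two-sided Eulerian polynomial $$A_{\mathrm{Simp}_m}(s,t)=\sum_{\sigma\in \mathrm{Simp}_m}s^{\mathrm{des}(\sigma)}t^{\mathrm{ides}(\sigma)}$$ of the set $\mathrm{Simp}_m$ of simple permutations in $\mathcal{S}_m$ is gamma-positive (of darga $m-1$). Then for each $n\ge1$ there exist non-negative integers $\gamma_{n,i,j}$ ($i,j\ge0$, $2i+j\le n-1$) such that $$A_{W_n}(s,t)=\sum_{i,j}\gamma_{n,i,j}\,(st)^i(s+t)^j(1+st)^{n-1-j-2i},$$ where $A_{W_n}(s,t)=\sum_{\pi\in W_n}s^{\mathrm{des}(\pi)}t^{\mathrm{ides}(\pi)}$ and $W_n$ is the set of block-wise simple permutations in $\mathcal{S}_n$.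
   Context: $\mathcal{S}_n$ is the set of permutations of $\{1,\dots,n\}$, written in one-line notation. For $\pi\in\mathcal{S}_n$, $\mathrm{des}(\pi)=|\{i\in\{1,\dots,n-1\}:\pi(i)>\pi(i+1)\}|$ and $\mathrm{ides}(\pi)=\mathrm{des}(\pi^{-1})$. A polynomial $A(s,t)$ is (bivariate) palindromic of darga $m-1$ if $A(s,t)=A(t,s)$ and $A(s,t)=(st)^{m-1}A(1/s,1/t)$. The polynomials $(st)^i(s+t)^j(1+st)^{m-1-j-2i}$ with $i,j\ge0$, $2i+j\le m-1$ form a basis (the bivariate gamma basis) of the space of such polynomials; a palindromic polynomial of darga $m-1$ is gamma-positive if all its coefficients in this basis are non-negative integers (the zero polynomial is regarded as palindromic of every non-negative darga and is gamma-positive). An interval of $\pi=a_1\cdots a_n\in\mathcal{S}_n$ is a non-empty contiguous sequence of entries $a_ia_{i+1}\cdots a_{i+k}$ whose values form a set of consecutive integers. The whole permutation and the single entries are the trivial intervals; all others are proper. A permutation is simple if it has no proper intervals. Inflation: for $\sigma\in\mathcal{S}_k$ and $\alpha_i\in\mathcal{S}_{n_i}$ ($n_i\ge1$, $1\le i\le k$), $\sigma[\alpha_1,\dots,\alpha_k]\in\mathcal{S}_{n_1+\cdots+n_k}$ is the permutation obtained by replacing the $i$-th entry of $\sigma$, for each $i$, by a block of $n_i$ consecutive positions and consecutive values that is order-isomorphic to $\alpha_i$, the blocks being in the same relative order (in values) as the entries of $\sigma$. Example: $2413[213,21,132,1]=546\,98\,132\,7$. Block-wise simple permutations are defined recursively: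 (1) the permutation $1\in\mathcal{S}_1$ is block-wise simple; (2) $\pi\in\mathcal{S}_n$ is block-wise simple if there are a simple permutation $\sigma\in\mathcal{S}_k$ with $k\ge 4$ and block-wise simple permutations $\alpha_1,\dots,\alpha_k$ such that $\pi=\sigma[\alpha_1,\dots,\alpha_k]$. No other permutations are block-wise simple. *)

(* Defs.v *)
From HB Require Import structures.
From mathcomp Require Import all_boot all_order all_algebra all_fingroup.
From mathcomp Require Import mpoly boolp.

Set Implicit Arguments.
Unset Strict Implicit.
Unset Printing Implicit Defensive.

Import GRing.Theory.

(* Permutations of {1, ..., n} are elements of 'S_n: both positions and values
   are shifted to {0, ..., n-1}. *)

Section Permutations.
Variable n : nat.
Implicit Types (p : 'S_n) (A : {set 'I_n}).

Definition des p : nat :=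
  #|[set i : 'I_n | [exists j : 'I_n, (j == i.+1 :> nat) && (p j < p i)]]|.

Definition ides p : nat := des p^-1%g.

Definition consecutive A : bool :=
  [exists a : 'I_n, exists b : 'I_n, A == [set x : 'I_n | a <= x <= b]].

(* An interval is represented by the set of its positions. *)
Definition interval p A : bool :=
  [&& A != set0, consecutive A & consecutive (p @: A)].

Definition trivial_interval A : bool := (A == setT) || (#|A| == 1).

Definition simple_perm p : bool :=
  [forall A : {set 'I_n}, interval p A ==> trivial_interval A].

End Permutations.

Section Inflation.
Variables (k : nat) (sigma : 'S_k) (sz : 'I_k -> nat).
Variable alpha : forall i : 'I_k, 'S_(sz i).

(* The value of the inflation at the a-th position of the i-th block. *)
Definition inflation_val (i : 'I_k) (a : 'I_(sz i)) : nat :=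
  \sum_(j < k | sigma j < sigma i) sz j + alpha i a.

Lemma inflation_val_lt_block i a :
  @inflation_val i a < \sum_(j < k | sigma j <= sigma i) sz j.
Proof.
rewrite /inflation_val [ltnRHS](bigD1 i) //= addnC.
have -> : \sum_(j < k | (sigma j <= sigma i) && (j != i)) sz j =
          \sum_(j < k | sigma j < sigma i) sz j.
  apply: eq_bigl => j; rewrite ltn_neqAle andbC; congr (~~ _ && _).
  by rewrite val_eqE (inj_eq perm_inj).
by rewrite ltn_add2r.
Qed.

Lemma inflation_val_lt i a : @inflation_val i a < \sum_(j < k) sz j.
Proof.
apply: (leq_trans (inflation_val_lt_block a)).
by rewrite [leqRHS](bigID (fun j => sigma j <= sigma i)) /= leq_addr.
Qed.

Lemma inflation_val_mono i i' a a' : sigma i < sigma i' ->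
  @inflation_val i a < @inflation_val i' a'.
Proof.
move=> lt_ii'; apply: (leq_trans (inflation_val_lt_block a)).
apply: leq_trans (leq_addr _ _).
rewrite [leqRHS](bigID (fun j => sigma j <= sigma i)) /=.
rewrite (eq_bigl (fun j => (sigma j < sigma i') && (sigma j <= sigma i))).
  exact: leq_addr.
move=> j; case: (leqP (sigma j) (sigma i)) => [le_ji|]; last by rewrite andbF.
by rewrite (leq_ltn_trans le_ji lt_ii').
Qed.

Definition inflation_fun (x : 'I_(\sum_(j < k) sz j)) : 'I_(\sum_(j < k) sz j) :=
  Ordinal (inflation_val_lt (tagnat.sig2 x)).

Lemma inflation_fun_inj : injective inflation_fun.
Proof.
move=> x y /(congr1 val) /=.
suff: inflation_val (tagnat.sig2 x) = inflation_val (tagnat.sig2 y) ->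
  tagnat.Rank _ (tagnat.sig2 x) = tagnat.Rank _ (tagnat.sig2 y).
  by rewrite !tagnat.sig2K.
move: (tagnat.sig2 x) (tagnat.sig2 y).
move: (tagnat.sig1 x) (tagnat.sig1 y) => i i' a a'.
case: (ltngtP (sigma i) (sigma i')) => [lt_ii'|lt_i'i|].
- by move=> e; have := inflation_val_mono a a' lt_ii'; rewrite e ltnn.
- by move=> e; have := inflation_val_mono a' a lt_i'i; rewrite e ltnn.
move=> /val_inj /perm_inj eq_ii'; case: _ / eq_ii' in a' *.
by rewrite /inflation_val => /addnI /val_inj /perm_inj ->.
Qed.

Definition inflation : 'S_(\sum_(j < k) sz j) := perm inflation_fun_inj.

Lemma inflationE (i : 'I_k) (a : 'I_(sz i)) :
  inflation (tagnat.Rank i a)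
  = \sum_(j < k | sigma j < sigma i) sz j + alpha i a :> nat.
Proof.
rewrite permE /= /tagnat.Rank /tagnat.sig2 /tagnat.sig1 tagnat.rankK /=.
by [].
Qed.

End Inflation.

(* The condition n_i >= 1 on the blocks is automatic here, there being no
   block-wise simple permutation in 'S_0. *)
Inductive block_wise_simple : forall n : nat, 'S_n -> Prop :=
| block_wise_simple1 : block_wise_simple (1%g : 'S_1)
| block_wise_simple_inflation (k : nat) (sigma : 'S_k) (sz : 'I_k -> nat)
    (alpha : forall i : 'I_k, 'S_(sz i)) :
    4 <= k -> simple_perm sigma ->
    (forall i, block_wise_simple (alpha i)) ->
    block_wise_simple (inflation sigma alpha).

Definition Simp (m : nat) : {set 'S_m} := [set p | simple_perm p].

Definition W (n : nat) : {set 'S_n} := [set p | `[< block_wise_simple p >]].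

Local Open Scope ring_scope.

Local Notation "x %:F" := (FracField.tofrac x).
Notation bipoly := {mpoly int[2]}.

Definition vs : bipoly := 'X_ord0.
Definition vt : bipoly := 'X_ord_max.

Definition eval2 (K : comNzRingType) (x y : K) (A : bipoly) : K :=
  mmap intr (fun i : 'I_2 => if i == ord0 then x else y) A.

Definition two_sided_eulerian (n : nat) (P : {set 'S_n}) : bipoly :=
  \sum_(p in P) vs ^+ des p * vt ^+ ides p.

(* The second identity is read in the field of fractions of Z[s, t]. *)
Definition palindromic (d : nat) (A : bipoly) : Prop :=
  A = eval2 vt vs A /\
  A%:F = (vs * vt)%:F ^+ d * eval2 (vs%:F)^-1 (vt%:F)^-1 A.

Definition gamma_basis (d i j : nat) : bipoly :=
  (vs * vt) ^+ i * (vs + vt) ^+ j * (1 + vs * vt) ^+ (d - j - 2 * i).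

(* The expansion in the gamma basis of darga d; only the coefficients
   c i j with 2 i + j <= d are used. *)
Definition gamma_expansion (d : nat) (c : nat -> nat -> nat) : bipoly :=
  \sum_(0 <= i < d.+1) \sum_(0 <= j < d.+1 | (2 * i + j <= d)%N)
    (c i j)%:R * gamma_basis d i j.

Definition gamma_positive (d : nat) (A : bipoly) : Prop :=
  palindromic d A /\ exists c : nat -> nat -> nat, A = gamma_expansion d c.

(* Main.v *)
(* Let [p] be an inflation of a simple permutation [sigma] of length at least 4,
   with non-empty blocks. An interval of [p] meets a set of blocks that is an
   interval of [sigma], hence a single block or all of them. In the latter case
   it contains every block that is not extremal both in position and in value,
   and a simple permutation has no entry at such a corner; so it is everything.
   Hence the blocks are the maximal intervals other than the whole, and the
   decomposition of [p] is unique. As des and ides are additive under inflation,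
   for n > 1
     A_{W_n} = sum_{k >= 4} A_{Simp_k} sum_{n_1 + ... + n_k = n} prod_i A_{W_{n_i}},
   and gamma expansions multiply, the dargas adding up to
   (k - 1) + sum_i (n_i - 1) = n - 1. *)
Require Import Defs.
From mathcomp Require Import all_boot all_order all_algebra all_fingroup.
From mathcomp Require Import mpoly boolp zify.
(* Undoes the shadowing of [interval] by mathcomp's intervals. *)
Import Defs.

Set Implicit Arguments.
Unset Strict Implicit.
Unset Printing Implicit Defensive.

Import GRing.Theory.

(** * Intervals of inflations *)

Definition convex n (A : {set 'I_n}) : Prop :=
  forall x y z : 'I_n, x \in A -> z \in A -> x <= y <= z -> y \in A.

Lemma consecutiveP n (A : {set 'I_n}) :
  A != set0 -> reflect (convex A) (consecutive A).
Proof.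
move=> /set0Pn A0; apply: (iffP idP) => [/existsP[a /existsP[b /eqP->]] x y z|cA].
  by rewrite !inE; lia.
have [x0 x0A] := A0.
case: (arg_minnP (fun x : 'I_n => x : nat) x0A) => a aA a_min.
case: (arg_maxnP (fun x : 'I_n => x : nat) x0A) => b bA b_max.
apply/existsP; exists a; apply/existsP; exists b; apply/eqP/setP => x; rewrite inE.
apply/idP/idP => [xA|]; last exact: cA.
by apply/andP; split; [exact: a_min | exact: b_max].
Qed.

Lemma interval_convex n (p : 'S_n) (A : {set 'I_n}) :
  interval p A -> convex A /\ convex (p @: A).
Proof.
case/and3P => A0 cA cpA; split; first exact/consecutiveP.
by apply/consecutiveP => //; rewrite imset_eq0.
Qed.

Lemma convex_interval n (p : 'S_n) (A : {set 'I_n}) :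
  A != set0 -> convex A -> convex (p @: A) -> interval p A.
Proof.
by move=> A0 cA cpA; apply/and3P; split=> //; apply/consecutiveP; rewrite ?imset_eq0.
Qed.

(** Used for positions and for values: an entry of [p] at position [i] sits in a corner of the
    diagram when both [i] and [p i] are extremal. *)
Definition extremal n (i : 'I_n) : Prop :=
  (forall j : 'I_n, i <= j) \/ (forall j : 'I_n, j <= i).

Lemma convex_setC1 n (i : 'I_n) : extremal i -> convex [set~ i].
Proof.
move=> ext x y z; rewrite !inE => xi zi xyz; apply/eqP => yi; subst y.
have nxi : x != i :> nat by [].
have nzi : z != i :> nat by [].
by case: ext => [/(_ x)|/(_ z)]; lia.
Qed.

Lemma exists_neq n (i : 'I_n) : 1 < n -> exists j, j != i.
Proof.
move=> n_gt1; have /card_gt0P[j] : 0 < #|[set~ i]|.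
  by rewrite cardsC1 card_ord; lia.
by rewrite !inE; exists j.
Qed.

(** Removing a corner entry leaves [n - 1] entries that are consecutive in position and in value.
    For [n > 2] this would be a proper interval. *)
Lemma simple_perm_corner n (p : 'S_n) (i : 'I_n) :
  2 < n -> simple_perm p -> extremal i -> ~ extremal (p i).
Proof.
move=> n_gt2 /forallP/(_ [set~ i])/implyP simp ext_i ext_pi.
have card_C : #|[set~ i]| = n.-1 by rewrite cardsC1 card_ord.
suff /simp : interval p [set~ i].
  case/orP => /eqP e; last by rewrite card_C in e; lia.
  by have := in_setT i; rewrite -e !inE eqxx.
apply: convex_interval; last 2 first.
- exact: convex_setC1.
- suff -> : p @: [set~ i] = [set~ p i] by exact: convex_setC1.
  apply/setP => y; rewrite -(permKV p y) mem_imset; last exact: perm_inj.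
  by rewrite !inE (inj_eq perm_inj).
by rewrite -card_gt0 card_C; lia.
Qed.

(* [p] is obtained from [sigma] by replacing the entry at position [i] by the
   block of the entries at the positions [x] with [b x = i]. *)
Definition inflates n k (p : 'S_n) (sigma : 'S_k) (b : 'I_n -> 'I_k) : Prop :=
  [/\ forall x y : 'I_n, x <= y -> b x <= b y,
      forall i, exists x, b x = i
    & forall x y, sigma (b x) < sigma (b y) -> p x < p y].

Section Inflates.
Variables (n k : nat) (p : 'S_n) (sigma : 'S_k) (b : 'I_n -> 'I_k).
Hypothesis infl : inflates p sigma b.

Lemma inflates_ltl (x y : 'I_n) : b x < b y -> x < y.
Proof.
case: infl => mono _ _; rewrite !ltnNge; apply: contra => /mono.
by [].
Qed.

(** Exchanges positions and values: the value [v] lies in the block of position [p^-1 v], and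
    [sigma] ranks the blocks by value. Every statement about positions thereby yields one about
    values. *)
Lemma inflates_inv :
  inflates p^-1 sigma^-1 (fun v => sigma (b (p^-1%g v))).
Proof.
case: infl => mono surj val; split=> [v w|i|v w].
- by move=> le_vw; rewrite leqNgt; apply/negP => /val; rewrite !permKV ltnNge le_vw.
- by have [x bx] := surj (sigma^-1%g i); exists (p x); rewrite permK bx permKV.
by rewrite !permK => /inflates_ltl.
Qed.

Lemma convex_imset_block A : convex A -> convex (b @: A).
Proof.
case: infl => mono surj _ cA i j l /imsetP[x xA ->] /imsetP[z zA ->].
have [y <-] := surj j.
move=> /andP[le_xy le_yz].
have [<-|neq_xy] := eqVneq (b x) (b y); first exact: imset_f.
have [->|neq_yz] := eqVneq (b y) (b z); first exact: imset_f.
apply/imset_f/(cA x _ z) => //.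
by apply/andP; split; apply/ltnW/inflates_ltl; rewrite ltn_neqAle ?neq_xy ?neq_yz.
Qed.

(** A non-extremal block has a block on either side. [A] has a point in each of these, and convexity
    fills in everything between. *)
Lemma setT_of_blocks A y :
  convex A -> b @: A = setT -> ~ extremal (b y) -> y \in A.
Proof.
move=> cA bAT next.
have [[i ltiy]|] := pselect (exists i : 'I_k, i < b y); last first.
  move=> none; case: next; left=> j; rewrite leqNgt; apply/negP => ltjy.
  by case: none; exists j.
have [[l ltyl]|] := pselect (exists l : 'I_k, b y < l); last first.
  move=> none; case: next; right=> j; rewrite leqNgt; apply/negP => ltyj.
  by case: none; exists j.
have /imsetP[x xA ei] : i \in b @: A by rewrite bAT inE.
have /imsetP[z zA el] : l \in b @: A by rewrite bAT inE.
apply: (cA x _ z) => //.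
by apply/andP; split; apply/ltnW/inflates_ltl; rewrite -?ei -?el.
Qed.

Lemma convex_block i : convex [set x | b x == i].
Proof.
case: infl => mono _ _ x y z; rewrite !inE => /eqP xi /eqP zi /andP[xy yz].
apply/eqP/val_inj/eqP; rewrite eqn_leq.
by move: (mono _ _ xy) (mono _ _ yz); rewrite xi zi => -> ->.
Qed.

End Inflates.

Section InflatesSimple.
Variables (n k : nat) (p : 'S_n) (sigma : 'S_k) (b : 'I_n -> 'I_k).
Hypothesis infl : inflates p sigma b.

Lemma imset_block_inv (A : {set 'I_n}) :
  (fun v => sigma (b (p^-1%g v))) @: (p @: A) = sigma @: (b @: A).
Proof.
by rewrite -!imset_comp; apply: eq_imset => x /=; rewrite permK.
Qed.

Lemma block_interval i : interval p [set x | b x == i].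
Proof.
have [mono surj _] := infl.
apply: convex_interval; first 2 last.
- suff -> : p @: [set x | b x == i] =
    [set v | sigma (b (p^-1%g v)) == sigma i].
    exact: convex_block (inflates_inv infl) _.
  apply/setP => v; rewrite inE -{1}(permKV p v) mem_imset; last exact: perm_inj.
  by rewrite inE (inj_eq perm_inj).
- by have [x bx] := surj i; apply/set0Pn; exists x; rewrite inE bx.
exact: (convex_block infl).
Qed.

(** The blocks met by [A] form an interval of [sigma], hence a single block or all of them. If all
    are met, each entry is forced into [A] by convexity, either in position or in value, since no
    block sits in a corner. *)
Lemma interval_in_block A x y : 2 < k -> simple_perm sigma ->
  interval p A -> A != setT -> x \in A -> y \in A -> b x = b y.
Proof.
move=> k_gt2 simp intA AnT xA yA.
have [cA cpA] := interval_convex intA.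
have cbA := convex_imset_block infl cA.
have csbA := convex_imset_block (inflates_inv infl) cpA.
rewrite imset_block_inv in csbA.
have int_bA : interval sigma (b @: A).
  by apply: convex_interval => //; rewrite imset_eq0; apply/set0Pn; exists x.
have /implyP/(_ int_bA)/orP[/eqP bT|/cards1P[i bAi]] := forallP simp (b @: A).
- case/negP: AnT; apply/eqP/setP => z; rewrite inE.
  have [ext_bz|next_bz] := pselect (extremal (b z)); last first.
    exact: (setT_of_blocks infl).
  (* The block of [z] is extremal in position, hence not in value, so the argument is repeated with
     values for positions. *)
  have next_sbz := simple_perm_corner k_gt2 simp ext_bz.
  rewrite -(mem_imset _ _ (@perm_inj _ p)).
  apply: (setT_of_blocks (inflates_inv infl)) => //; last by rewrite permK.
  rewrite imset_block_inv bT; apply/setP => i; rewrite !inE.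
  by rewrite -(permKV sigma i) imset_f.
have := imset_f b xA; have := imset_f b yA.
by rewrite bAi !inE => /eqP-> /eqP->.
Qed.

Lemma block_neqT i : 1 < k -> [set x | b x == i] != setT.
Proof.
move=> k_gt1; have [_ surj _] := infl.
have [j ji] := exists_neq i k_gt1.
have [x bx] := surj j; apply/negP => /eqP /setP/(_ x).
by rewrite !inE bx (negbTE ji).
Qed.

End InflatesSimple.

(** * Uniqueness of the simple quotient and of its blocks *)

Lemma inflates_same_block n k k' (p : 'S_n) (sigma : 'S_k) (sigma' : 'S_k') b b' x y :
  inflates p sigma b -> inflates p sigma' b' ->
  2 < k -> 2 < k' -> simple_perm sigma' ->
  b x = b y -> b' x = b' y.
Proof.
move=> infl infl' k_gt2 k'_gt2 simp' bxy.
(* A block of the first decomposition is an interval of [p] other than the whole, hence lies inside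
   one block of the second. *)
apply: (interval_in_block infl' k'_gt2 simp' (block_interval infl (b x))).
- by apply: (block_neqT infl); lia.
- by rewrite inE.
by rewrite inE bxy.
Qed.

Lemma inflates_first n k (p : 'S_n) (sigma : 'S_k) b (x : 'I_n) :
  inflates p sigma b -> x = 0 :> nat -> b x = 0 :> nat.
Proof.
move=> [mono surj _] x0; apply/eqP; rewrite -leqn0.
have k_gt0 : 0 < k by apply: leq_ltn_trans (ltn_ord (b x)).
by have [y by0] := surj (Ordinal k_gt0); have := mono x y; rewrite by0 /= x0; apply.
Qed.

Lemma inflates_last n k (p : 'S_n) (sigma : 'S_k) b (x : 'I_n) :
  inflates p sigma b -> x.+1 = n -> (b x).+1 = k.
Proof.
move=> [mono surj _] x0; apply/eqP; rewrite eqn_leq ltn_ord /= leqNgt.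
apply/negP => lt_bx; have [y by0] := surj (Ordinal lt_bx).
have := mono y x; rewrite by0 /= -ltnS x0.
by move=> /(_ (ltn_ord y)); rewrite ltnn.
Qed.

(** A monotone surjection onto an initial segment cannot skip a value, so [b] grows by at most one
    from a position to the next. *)
Lemma inflates_next n k (p : 'S_n) (sigma : 'S_k) b (x y : 'I_n) :
  inflates p sigma b -> y = x.+1 :> nat -> b y = b x + (b x != b y) :> nat.
Proof.
move=> infl yx; have [mono surj _] := infl.
have le_xy : b x <= b y by apply: mono; lia.
case: eqVneq => [->|]; first by rewrite addn0.
rewrite -val_eqE /= => neq_xy; rewrite addn1; apply/eqP.
rewrite eqn_leq; apply/andP; split; last by lia.
rewrite leqNgt; apply/negP => lt_xy.
have lt_k : (b x).+1 < k by apply: ltn_trans lt_xy _.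
have [z bz] := surj (Ordinal lt_k).
have := @inflates_ltl _ _ _ _ _ infl x z; have := @inflates_ltl _ _ _ _ _ infl z y.
by rewrite bz /=; lia.
Qed.

Lemma inflates_unique n k k' (p : 'S_n) (sigma : 'S_k) (sigma' : 'S_k') b b' :
  inflates p sigma b -> inflates p sigma' b' ->
  2 < k -> 2 < k' -> simple_perm sigma -> simple_perm sigma' ->
  k = k' /\ forall x, b x = b' x :> nat.
Proof.
move=> infl infl' k_gt2 k'_gt2 simp simp'.
have same x y : (b x != b y) = (b' x != b' y).
  by congr (~~ _); apply/eqP/eqP; [exact: (inflates_same_block infl infl')
                                 | exact: (inflates_same_block infl' infl)].
(* Both block maps start at 0 and step up by one at the same positions. *)
have eqb x : b x = b' x :> nat.
  case: x => m; elim: m => [|m IHm] lt_m.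
    by rewrite (inflates_first infl) ?(inflates_first infl').
  have lt_m' : m < n by apply: ltnW.
  rewrite (@inflates_next _ _ _ _ _ (Ordinal lt_m') _ infl) //.
  by rewrite (@inflates_next _ _ _ _ _ (Ordinal lt_m') _ infl') // IHm same.
split=> //.
(* The last position lies in the last block, so its block index reveals the number of blocks. *)
have [_ surj _] := infl.
have k_gt0 : 0 < k by lia.
have [x _] := surj (Ordinal k_gt0).
have lt_n : n.-1 < n by have := ltn_ord x; lia.
have lastn : (Ordinal lt_n).+1 = n by rewrite /=; lia.
by rewrite -(inflates_last infl lastn) -(inflates_last infl' lastn) eqb.
Qed.

(** A value, counted from 0, is the number of entries with a smaller value, so the relative order
    determines the permutation. *)
Lemma perm_eq_order k (s t : 'S_k) :
  (forall i j, s i < s j -> t i < t j) -> s = t.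
Proof.
have perm_count (u : 'S_k) i : u i = \sum_(j < k | u j < u i) 1 :> nat.
  rewrite (reindex_inj (@perm_inj _ u^-1)) /=.
  rewrite (eq_bigl (fun j : 'I_k => j < u i)); last by move=> j; rewrite permKV.
  by rewrite -(big_ord_widen _ (fun=> 1) (ltnW (ltn_ord (u i)))) sum1_card card_ord.
move=> st; apply/permP => i; apply/val_inj; rewrite /= (perm_count s) (perm_count t).
apply: eq_bigl => j; apply/idP/idP => [/st//|lt_t].
rewrite ltnNge leq_eqVlt; apply/negP => /orP[/eqP/val_inj/perm_inj eij|/st].
  by rewrite eij ltnn in lt_t.
lia.
Qed.

Lemma inflates_perm_unique n k (p : 'S_n) (sigma sigma' : 'S_k) b :
  inflates p sigma b -> inflates p sigma' b -> sigma = sigma'.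
Proof.
move=> [_ surj val] [_ _ val']; apply: perm_eq_order => i j.
have [x <-] := surj i; have [y <-] := surj j => lt_xy.
case: (ltngtP (sigma' (b x)) (sigma' (b y))) => // [/val'|/val_inj/perm_inj eq_xy].
  by rewrite ltnNge ltnW // val.
by rewrite eq_xy ltnn in lt_xy.
Qed.

(** * Descents of inflations *)

Definition block_des n k (p : 'S_n) (b : 'I_n -> 'I_k) (i : 'I_k) : nat :=
  #|[set x : 'I_n | [exists y : 'I_n, [&& b x == i, b y == i, y == x.+1 :> nat & p y < p x]]]|.

(** A descent of [p] either crosses from one block to the next, where it records a descent of
    [sigma], or lies inside a block. *)
Lemma des_inflates n k (p : 'S_n) (sigma : 'S_k) b :
  inflates p sigma b -> des p = des sigma + \sum_i block_des p b i.
Proof.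
move=> infl; have [mono surj val] := infl.
pose D : {set 'I_n} := [set x : 'I_n | [exists y : 'I_n, (y == x.+1 :> nat) && (p y < p x)]].
(* [S] collects the positions whose successor is in the same block, so [D :\: S] consists of the
   descents across block boundaries. *)
pose S : {set 'I_n} := [set x : 'I_n | [exists y : 'I_n, (y == x.+1 :> nat) && (b x == b y)]].
rewrite /des -/D -(cardsID S D) addnC; congr (_ + _).
  have nextP x : x \in D :\: S ->
      exists y : 'I_n, [/\ y = x.+1 :> nat, b y = (b x).+1 :> nat & p y < p x].
    rewrite !inE => /andP[nS /existsP[y /andP[/eqP yx lt_p]]]; exists y; split=> //.
    rewrite (inflates_next infl yx); case: eqVneq => [e|_]; last by rewrite addn1.
    by case/existsP: nS; exists y; rewrite yx e !eqxx.
  (* [b] is injective on these descents, since each is at the last position of its block. *)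
  rewrite -(@card_in_imset _ _ b (D :\: S)) => [|x x']; last first.
    move=> /nextP[y [yx byx _]] /nextP[y' [yx' byx' _]] e.
    apply/val_inj/eqP; rewrite eqn_leq; apply/andP; split; rewrite leqNgt; apply/negP => lt.
      have := mono y' x; rewrite byx' yx' -e ltnn => nlt; exact: notF (nlt lt).
    have := mono y x'; rewrite byx yx e ltnn => nlt; exact: notF (nlt lt).
  apply: eq_card => i; rewrite !inE; apply/imsetP/existsP.
    move=> [x /nextP[y [yx byx lt_p]] ->]; exists (b y); rewrite byx eqxx /=.
    case: (ltngtP (sigma (b x)) (sigma (b y))) => // [/val|/val_inj/perm_inj e].
      by rewrite ltnNge ltnW.
    by move: byx; rewrite e; lia.
  move=> [j /andP[/eqP ji lt_s]].
  (* Conversely, a descent [i] of [sigma] comes from the last position of block [i], whose successor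
     opens block [j]. *)
  have [x0 bx0] := surj i; have [z bz] := surj j.
  have Px0 : b x0 == i by apply/eqP.
  case: (@arg_maxnP _ x0 (fun x => b x == i) (fun x : 'I_n => x : nat) Px0) => x /eqP bx x_max.
  have lt_xz : x < z by apply: (inflates_ltl infl); rewrite bx bz ji.
  have lt_n : x.+1 < n by apply: leq_ltn_trans (ltn_ord z).
  pose y := Ordinal lt_n.
  have yx : y = x.+1 :> nat by [].
  have nby : b y != i by apply/negP => /x_max /=; lia.
  have byj : b y = j.
    apply/val_inj; rewrite /= (inflates_next infl yx) bx eq_sym nby ji.
    by rewrite addn1.
  exists x => //; rewrite !inE; apply/andP; split.
    apply/existsP => -[y' /andP[/eqP y'x /eqP e]].
    have y'y : y' = y by apply: val_inj.
    by rewrite -y'y -e bx eqxx in nby.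
  by apply/existsP; exists y; rewrite yx eqxx val // bx byj.
rewrite -sum1_card (partition_big b predT) //=.
apply: eq_bigr => i _; rewrite sum1_card; apply: eq_card => x.
rewrite !inE; apply/andP/existsP.
  move=> [/setIP[]]; rewrite !inE => /existsP[y /andP[/eqP yx lt_p]].
  move=> /existsP[y' /andP[/eqP y'x /eqP e]] bx.
  have y'y : y' = y by apply: val_inj; rewrite /= y'x yx.
  by exists y; rewrite -{1}y'y -e bx yx eqxx.
move=> [y /and4P[bx /eqP bY yx lt_p]]; split=> //.
by apply/setIP; split; rewrite inE; apply/existsP; exists y; rewrite yx ?lt_p // bY.
Qed.

(** [f] enumerates the positions of the block. Being a shift, it preserves and reflects adjacency,
    so descents correspond. Leaving [f] general covers both an inflation and its inverse. *)
Lemma block_des_embed m n k (p : 'S_n) (alpha : 'S_m) (b : 'I_n -> 'I_k) i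
    (f : 'I_m -> 'I_n) (o : nat) :
  (forall a, f a = o + a :> nat) ->
  (forall x, b x = i <-> exists a, x = f a) ->
  (forall a a', (p (f a) < p (f a')) = (alpha a < alpha a')) ->
  block_des p b i = des alpha.
Proof.
move=> f_shift f_block f_order.
have f_inj : injective f.
  by move=> a a' /(congr1 val) /=; rewrite !f_shift => /addnI/val_inj.
rewrite /block_des /des -(card_imset _ f_inj); apply: eq_card => x.
rewrite inE; apply/existsP/imsetP.
  move=> [y /and4P[/eqP/f_block[a ->] /eqP/f_block[a' ->] /eqP]].
  rewrite !f_shift -addnS => /addnI a'a lt_p; exists a => //.
  by rewrite inE; apply/existsP; exists a'; rewrite a'a eqxx -f_order.
move=> [a]; rewrite inE => /existsP[a' /andP[/eqP a'a lt_a]] ->; exists (f a').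
by rewrite f_order lt_a !f_shift a'a addnS eqxx !andbT;
  apply/andP; split; apply/eqP/f_block; eexists.
Qed.

(** * Additivity of [des] and [ides] under inflation *)

Section Inflation.
Variables (k : nat) (sigma : 'S_k) (sz : 'I_k -> nat).
Variable alpha : forall i : 'I_k, 'S_(sz i).
Hypothesis sz_gt0 : forall i, 0 < sz i.

Lemma inflation_inflates :
  inflates (inflation sigma alpha) sigma (@tagnat.sig1 k sz).
Proof.
split=> [x y le_xy|i|x y lt_s].
- by have := @tagnat.le_sig1 k sz x y; rewrite !leEord; apply.
- by exists (tagnat.Rank i (Ordinal (sz_gt0 i))); rewrite tagnat.Rank1K.
by rewrite !permE /=; apply: inflation_val_mono.
Qed.

Lemma sig1_Rank (i : 'I_k) (x : 'I_(\sum_i sz i)) :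
  tagnat.sig1 x = i <-> exists a, x = tagnat.Rank i a.
Proof.
split=> [<-|[a ->]]; last exact: tagnat.Rank1K.
by exists (tagnat.sig2 x); rewrite tagnat.sig2K.
Qed.

Lemma inflation_order (i : 'I_k) a a' :
  (inflation sigma alpha (tagnat.Rank i a) < inflation sigma alpha (tagnat.Rank i a'))
  = (alpha i a < alpha i a').
Proof. by rewrite !inflationE ltn_add2l. Qed.

Lemma des_inflation :
  des (inflation sigma alpha) = des sigma + \sum_i des (alpha i).
Proof.
rewrite (des_inflates inflation_inflates); congr (_ + _); apply: eq_bigr => i _.
apply: (@block_des_embed _ _ _ _ _ _ _ (@tagnat.Rank k sz i)) => [a|x|a a'].
- exact: tagnat.RankEsum.
- exact: sig1_Rank.
exact: inflation_order.
Qed.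

Lemma ides_inflation :
  ides (inflation sigma alpha) = ides sigma + \sum_i ides (alpha i).
Proof.
rewrite /ides (des_inflates (inflates_inv inflation_inflates)); congr (_ + _).
(* In the inverse, the block coming from [alpha i] has index [sigma i]. *)
rewrite (reindex_inj (@perm_inj _ sigma)) /=; apply: eq_bigr => i _.
(* [f v] is the [v]-th smallest value in block [i], that is, the offset of the block plus [v]. *)
pose f v := inflation sigma alpha (tagnat.Rank i ((alpha i)^-1%g v)).
apply: (@block_des_embed _ _ _ _ _ _ _ f) => [v|w|v v'].
- by rewrite /f inflationE permKV.
- split=> [/perm_inj/sig1_Rank[a e]|[v ->]]; last by rewrite /f permK tagnat.Rank1K.
  by exists (alpha i a); rewrite /f permK -e permKV.
by rewrite /f !permK !tagnat.RankEsum ltn_add2l.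
Qed.

End Inflation.


(** * Gamma expansions *)

Section GammaCone.
Local Open Scope ring_scope.
Implicit Types A B : {mpoly int[2]}.

(** The expansion half of [gamma_positive]; it is closed under the sums and products that occur in
    the recursion. *)
Definition gamma_cone (d : nat) A : Prop :=
  exists c : nat -> nat -> nat, A = gamma_expansion d c.

Lemma gamma_cone0 d : gamma_cone d 0.
Proof.
exists (fun _ _ => 0%N); rewrite /gamma_expansion big1 // => i _.
by rewrite big1 // => j _; rewrite mul0r.
Qed.

Lemma gamma_coneD d A B : gamma_cone d A -> gamma_cone d B -> gamma_cone d (A + B).
Proof.
move=> [c ->] [c' ->]; exists (fun i j => (c i j + c' i j)%N).
rewrite /gamma_expansion -big_split; apply: eq_bigr => i _ /=.
by rewrite -big_split; apply: eq_bigr => j _ /=; rewrite natrD mulrDl.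
Qed.

Lemma gamma_cone_sum d (I : Type) (r : seq I) (P : pred I) (F : I -> {mpoly int[2]}) :
  (forall i, P i -> gamma_cone d (F i)) -> gamma_cone d (\sum_(i <- r | P i) F i).
Proof. by apply: big_ind; [exact: gamma_cone0 | move=> A B; exact: gamma_coneD]. Qed.

Lemma gamma_cone_basis d i j : (2 * i + j <= d)%N -> gamma_cone d (gamma_basis d i j).
Proof.
move=> le_d; exists (fun i' j' => ((i' == i) && (j' == j) : nat)).
rewrite /gamma_expansion (bigD1_seq i) ?iota_uniq ?mem_index_iota //=; last by lia.
rewrite [X in _ + X]big1 => [|i' /negbTE ni]; last first.
  by rewrite big1 // => j' _; rewrite ni mul0r.
rewrite addr0 big_mkcond (bigD1_seq j) ?iota_uniq ?mem_index_iota //=; last by lia.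
rewrite le_d !eqxx mul1r big1 ?addr0 // => j' /negbTE nj.
by case: ifP; rewrite // nj andbF mul0r.
Qed.

(** The bounds keep the truncated subtractions exact, so the exponents of [1 + st] add up like the
    others. *)
Lemma gamma_basisM d e i j i' j' : (2 * i + j <= d)%N -> (2 * i' + j' <= e)%N ->
  gamma_basis d i j * gamma_basis e i' j' = gamma_basis (d + e) (i + i') (j + j').
Proof.
move=> le_d le_e; rewrite /gamma_basis.
have -> : (d + e - (j + j') - 2 * (i + i') = (d - j - 2 * i) + (e - j' - 2 * i'))%N.
  by lia.
by rewrite !exprD mulrACA [X in X * _]mulrACA.
Qed.

Lemma gamma_coneM d e A B :
  gamma_cone d A -> gamma_cone e B -> gamma_cone (d + e) (A * B).
Proof.
move=> [c ->] [c' ->]; rewrite /gamma_expansion mulr_suml.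
apply: gamma_cone_sum => i _; rewrite mulr_suml; apply: gamma_cone_sum => j le_d.
rewrite mulr_sumr; apply: gamma_cone_sum => i' _.
rewrite mulr_sumr; apply: gamma_cone_sum => j' le_e.
rewrite mulrACA gamma_basisM // -natrM mulr_natl.
(* The coefficient is a natural number, so the term is a repeated sum of one basis element. *)
elim: (_ * _)%N => [|m IHm]; first exact: gamma_cone0.
by rewrite mulrS; apply: gamma_coneD => //; apply: gamma_cone_basis; lia.
Qed.

Lemma gamma_cone1 : gamma_cone 0 1.
Proof.
have -> : 1 = gamma_basis 0 0 0 by rewrite /gamma_basis !expr0 !mulr1.
exact: gamma_cone_basis.
Qed.

Lemma gamma_cone_prod (I : Type) (r : seq I) (d : I -> nat) (F : I -> {mpoly int[2]}) :
  (forall i, gamma_cone (d i) (F i)) ->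
  gamma_cone (\sum_(i <- r) d i)%N (\prod_(i <- r) F i).
Proof.
move=> coneF; elim: r => [|i r IHr]; first by rewrite !big_nil; exact: gamma_cone1.
by rewrite !big_cons; apply: gamma_coneM.
Qed.

End GammaCone.

(** * Decomposition of block-wise simple permutations *)

(** Distributivity when the index type of each sum depends on the factor: the expansion runs over
    dependent choice functions. *)
Lemma prod_sum_fprod (R : comNzRingType) (I : finType) (T_ : I -> finType)
    (Q : forall i, pred (T_ i)) (F : forall i, T_ i -> R) :
  (\prod_i \sum_(x | Q i x) F i x =
   \sum_(t : fprod T_ | [forall i, Q i (t i)]) \prod_i F i (t i))%R.
Proof.
(* Extending [F] by zero absorbs the conditions [Q]; choices violating one contribute a zero
   factor. *)
pose G i : {ffun T_ i -> R} := [ffun x => if Q i x then F i x else 0%R].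
have sumG i : (\sum_(x | Q i x) F i x =
    \sum_(j in tagged_with T_ i) untag 0 (G i) j)%R.
  transitivity (\sum_x G i x)%R; last exact: (big_tag (fun i x => G i x) i).
  by rewrite big_mkcond; apply: eq_bigr => x _; rewrite ffunE.
rewrite (eq_bigr _ (fun i _ => sumG i)) bigA_distr_big_dep /= -big_fprod.
rewrite [RHS]big_mkcond; apply: eq_bigr => t _.
case: ifP => [/forallP Qt|/forallPn[i /negbTE nQ]].
  by apply: eq_bigr => i _; rewrite ffunE Qt.
by rewrite (bigD1 i) //= ffunE nQ mul0r.
Qed.

Lemma block_wise_simple_gt0 n (p : 'S_n) : block_wise_simple p -> 0 < n.
Proof.
elim=> // k sigma sz alpha k_ge4 _ _ sz_gt0.
have k_gt0 : 0 < k by lia.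
by rewrite (bigD1 (Ordinal k_gt0)) //= ltn_addr.
Qed.

(** For a given [n], the size of the inflation equals [n] only through a proof [e], hence the
    cast. *)
Lemma block_wise_simple_inv n (p : 'S_n) : block_wise_simple p -> n != 1 ->
  exists k (sigma : 'S_k) (sz : 'I_k -> nat) (alpha : forall i, 'S_(sz i))
         (e : \sum_i sz i = n),
    [/\ 4 <= k, simple_perm sigma, forall i, block_wise_simple (alpha i)
      & p = cast_perm e (inflation sigma alpha)].
Proof.
case=> // k sigma sz alpha k_ge4 simp bws _.
by exists k, sigma, sz, alpha, erefl; rewrite cast_perm_id.
Qed.

Lemma inflates_cast m n k (e : m = n) (p : 'S_m) (sigma : 'S_k) b :
  inflates p sigma b ->
  inflates (cast_perm e p) sigma (fun x => b (cast_ord (esym e) x)).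
Proof.
case: _ / e => infl; rewrite cast_perm_id.
suff -> : (fun x => b (cast_ord (esym erefl) x)) = b by [].
by apply: funext => x; rewrite cast_ord_id.
Qed.

Lemma block_wise_simple_cast m n (e : m = n) (p : 'S_m) :
  block_wise_simple p -> block_wise_simple (cast_perm e p).
Proof. by case: _ / e; rewrite cast_perm_id. Qed.

Lemma des_cast m n (e : m = n) (p : 'S_m) : des (cast_perm e p) = des p.
Proof. by case: _ / e; rewrite cast_perm_id. Qed.

Lemma ides_cast m n (e : m = n) (p : 'S_m) : ides (cast_perm e p) = ides p.
Proof. by case: _ / e; rewrite cast_perm_id. Qed.

(** Recovers the block sizes from the block map alone, as needed for uniqueness. *)
Lemma card_sig1 n k (sz : 'I_k -> nat) (e : \sum_i sz i = n) i :
  #|[set x | tagnat.sig1 (cast_ord (esym e) x) == i]| = sz i.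
Proof.
case: _ / e; rewrite -[RHS]card_ord -cardsT.
have Rank_inj : injective (@tagnat.Rank k sz i).
  by move=> a a' /(congr1 (@nat_of_ord _)); rewrite !tagnat.RankEsum => /addnI/val_inj.
rewrite -(card_imset _ Rank_inj); apply: eq_card => x; rewrite inE cast_ord_id.
apply/eqP/imsetP => [/sig1_Rank[a ->]|[a _ ->]]; last exact: tagnat.Rank1K.
by exists a.
Qed.

(** * Proper decompositions in bijection with [W n] *)

Section Decomposition.
Variable n : nat.

Definition composition (k : nat) : finType :=
  {s : {ffun 'I_k -> 'I_n.+1} | \sum_i (s i : nat) == n}.

Definition part k (s : composition k) (i : 'I_k) : nat := val s i.

Lemma part_sum k (s : composition k) : \sum_i part s i = n.
Proof. exact: eqP (valP s). Qed.

Definition blocks k (s : composition k) : finType :=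
  fprod (fun i : 'I_k => 'S_(part s i)).

Definition decomposition : finType :=
  {k : 'I_n.+1 & {s : composition k & ('S_k * blocks s)%type}}.

Definition assemble k (s : composition k) (t : 'S_k * blocks s) : 'S_n :=
  cast_perm (part_sum s) (inflation t.1 (fun i => t.2 i)).

Definition proper_at k (s : composition k) (t : 'S_k * blocks s) : bool :=
  (t.1 \in Simp k) && [forall i, t.2 i \in W (part s i)].

Definition recompose (t : decomposition) : 'S_n := assemble (tagged (tagged t)).

Definition proper (t : decomposition) : bool :=
  (4 <= tag t) && proper_at (tagged (tagged t)).

Lemma W_gt0 m (p : 'S_m) : p \in W m -> 0 < m.
Proof. by rewrite inE => /asboolP/block_wise_simple_gt0. Qed.

Lemma W_recompose : n != 1 -> W n = recompose @: [set t | proper t].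
Proof.
move=> n_neq1; apply/setP => p; apply/idP/imsetP; last first.
  move=> [[k [s [sigma alpha]]]]; rewrite inE => /and3P[/= k_ge4].
  rewrite inE => simp /forallP Walpha ->.
  rewrite inE; apply/asboolP; rewrite /recompose /assemble /=.
  apply: block_wise_simple_cast.
  by apply: block_wise_simple_inflation => // i; have := Walpha i; rewrite inE => /asboolP.
rewrite inE => /asboolP/block_wise_simple_inv/(_ n_neq1).
move=> [k [sigma [sz [alpha [e [k_ge4 simp bws ->]]]]]].
have sz_lt i : sz i < n.+1 by rewrite ltnS -e (bigD1 i) //= leq_addr.
have k_lt : k < n.+1.
  rewrite ltnS -e -[leqLHS]card_ord -sum1_card.
  by apply: leq_sum => i _; apply: block_wise_simple_gt0 (bws i).
pose f := [ffun i => Ordinal (sz_lt i)].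
have szE : sz = fun i => f i by apply: funext => i; rewrite ffunE.
have f_sum : \sum_i (f i : nat) == n by rewrite -[X in _ == X]e szE.
(* Replacing [sz] by [f] throughout gives [alpha] the very type of the blocks of [s], so no
   transport is required. *)
move: f szE f_sum => f szE f_sum; subst sz.
pose s : composition (Ordinal k_lt) := Sub f f_sum.
pose t : decomposition :=
  Tagged (fun k : 'I_n.+1 => {s : composition k & ('S_k * blocks s)%type})
    (Tagged (fun s : composition (Ordinal k_lt) => ('S_k * blocks s)%type)
      ((sigma, [fprod i => alpha i]) : 'S_k * blocks s)).
exists t.
  rewrite inE /proper /= k_ge4 /proper_at /= !inE simp /=.
  by apply/forallP => i; rewrite fprodE inE; apply/asboolP; exact: bws.
rewrite /recompose /assemble /= (eq_irrelevance (part_sum s) e).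
congr (cast_perm _ (inflation _ _)).
by apply: functional_extensionality_dep => i; rewrite fprodE.
Qed.

Lemma recompose_inj : {in [set t | proper t] &, injective recompose}.
Proof.
move=> [k [s [sigma alpha]]] [k' [s' [sigma' alpha']]].
rewrite !inE => /and3P[/= k_ge4]; rewrite inE => simp /forallP /= Walpha.
move=> /and3P[/= k'_ge4]; rewrite inE => simp' /forallP /= Walpha'.
rewrite /recompose /assemble /= => eq_t.
have infl := inflates_cast (part_sum s)
  (inflation_inflates sigma (fun i => alpha i) (fun i => W_gt0 (Walpha i))).
have infl' := inflates_cast (part_sum s')
  (inflation_inflates sigma' (fun i => alpha' i) (fun i => W_gt0 (Walpha' i))).
rewrite -eq_t in infl'.
have [] := inflates_unique infl infl' (ltnW k_ge4) (ltnW k'_ge4) simp simp'.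
(* The type of each later component depends on the earlier ones, so the equalities are obtained and
   eliminated in turn: number of blocks, sizes, [sigma], blocks. *)
move=> /val_inj eq_k; case: _ / eq_k in s' sigma' alpha' {k'_ge4} simp' Walpha' eq_t infl' *.
move=> eq_b.
have eq_s : s = s'.
  apply/val_inj/ffunP => i; apply: val_inj.
  rewrite /= -[LHS](card_sig1 (part_sum s)) -[RHS](card_sig1 (part_sum s')).
  by apply: eq_card => x; rewrite !inE -!val_eqE /= eq_b.
case: _ / eq_s in alpha' Walpha' eq_t infl' eq_b *.
have eq_sigma := inflates_perm_unique infl infl'.
rewrite -eq_sigma in eq_t *.
suff -> : alpha = alpha' by [].
apply/fprodP => i; apply/permP => a; apply: val_inj.
(* With [sigma] and the sizes shared, both values carry the same offset, which cancels. *)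
have := congr1 (fun p : 'S__ => p (tagnat.Rank i a) : nat) (cast_perm_inj eq_t).
by rewrite !inflationE => /addnI.
Qed.

(** * Recursion for the generating polynomial *)

Lemma weight_assemble k (s : composition k) (t : 'S_k * blocks s) :
  proper_at t ->
  (vs ^+ des (assemble t) * vt ^+ ides (assemble t) =
   vs ^+ des t.1 * vt ^+ ides t.1 *
   \prod_i (vs ^+ des (t.2 i) * vt ^+ ides (t.2 i)))%R.
Proof.
move=> /andP[_ /forallP Wt]; have part_gt0 i := W_gt0 (Wt i).
rewrite /assemble des_cast ides_cast des_inflation // ides_inflation //.
by rewrite !exprD !expr_sum big_split /= mulrACA.
Qed.

(** The sum over [W n] is carried along the bijection to nested sums over [k], [s] and the pair of
    [sigma] and the blocks. The weight is multiplicative, so the innermost sum factors. *)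
Lemma eulerian_W : n != 1 ->
  (two_sided_eulerian (W n) =
   \sum_(k < n.+1 | (3 < k)%N) \sum_(s : composition k)
     two_sided_eulerian (Simp k) * \prod_i two_sided_eulerian (W (part s i)))%R.
Proof.
move=> n_neq1; rewrite {1}/two_sided_eulerian W_recompose //.
rewrite big_imset /=; last exact: recompose_inj.
under eq_bigl => t do rewrite inE.
rewrite -(@sig_big_dep _ _ _ _
  (fun k : 'I_n.+1 => {s : composition k & ('S_k * blocks s)%type})
  (fun k : 'I_n.+1 => (3 < k)%N) (fun k t => proper_at (tagged t))
  (fun k t => let p := assemble (tagged t) in vs ^+ des p * vt ^+ ides p)%R).
apply: eq_bigr => k _.
rewrite -(@sig_big_dep _ _ _ _ (fun s : composition k => ('S_k * blocks s)%type)
  predT (fun s t => proper_at t)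
  (fun s t => let p := assemble t in vs ^+ des p * vt ^+ ides p)%R).
apply: eq_bigr => s _; rewrite (eq_bigr _ (@weight_assemble k s)).
rewrite prod_sum_fprod mulr_suml.
under [RHS]eq_bigr do rewrite mulr_sumr.
by rewrite pair_big_dep.
Qed.

Lemma gamma_cone_W :
  (forall m, 0 < m -> m < n -> gamma_cone (m - 1) (two_sided_eulerian (W m))) ->
  (forall m, 0 < m -> gamma_cone (m - 1) (two_sided_eulerian (Simp m))) ->
  n != 1 -> gamma_cone (n - 1) (two_sided_eulerian (W n)).
Proof.
move=> IH coneS n_neq1; rewrite eulerian_W //.
apply: gamma_cone_sum => k k_ge4; apply: gamma_cone_sum => s _.
have [[i part0]|part_gt0] := pselect (exists i, part s i = 0).
  suff : two_sided_eulerian (W (part s i)) = 0%R.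
    by rewrite [X in (_ * X)%R](bigD1 i) //= => ->; rewrite mul0r mulr0; exact: gamma_cone0.
  by rewrite /two_sided_eulerian big1 // => p /W_gt0 part_gt0; lia.
have {}part_gt0 i : 0 < part s i.
  by rewrite lt0n; apply/negP => /eqP part0; apply: part_gt0; exists i.
(* The darga count: the simple factor contributes [k - 1] and the blocks contribute [n - k] in
   total. *)
have k_le : \sum_(i < k) (part s i - 1) + k = n.
  rewrite -[RHS](part_sum s) -[X in _ + X]card_ord -sum1_card -big_split /=.
  by apply: eq_bigr => i _; rewrite subnK.
have -> : n - 1 = (k - 1) + \sum_(i < k) (part s i - 1) by lia.
apply: gamma_coneM; first by apply: coneS; lia.
apply: gamma_cone_prod => i; apply: IH => //.
have := part_sum s.
(* A second block, non-empty, makes block [i] shorter than [n], so the induction hypothesis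
   applies. *)
have [j ji] : exists j, j != i.
  by apply: exists_neq; lia.
rewrite (bigD1 i) //= (bigD1 j) //=; have := part_gt0 j; lia.
Qed.

End Decomposition.

(** * Base case and induction on the length *)

Lemma two_sided_eulerian_W1 : two_sided_eulerian (W 1) = 1%R.
Proof.
rewrite /two_sided_eulerian (big_pred1 1%g) => [|p].
  have des1 (p : 'S_1) : des p = 0.
    apply: eq_card0 => i; rewrite inE; apply/negbTE/existsP => -[j /andP[/eqP]].
    by rewrite !ord1.
  by rewrite /ides !des1 mulr1.
have -> : p = 1%g by apply/permP => i; rewrite !ord1.
rewrite [RHS]/= eqxx inE; apply/asboolP; exact: block_wise_simple1.
Qed.

Theorem theorem6p5
  (hSimp : forall m : nat, (0 < m)%N ->
     gamma_positive (m - 1)%N (two_sided_eulerian (Simp m)))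
  (n : nat) (hn : (0 < n)%N) :
  exists gamma : nat -> nat -> nat,
    two_sided_eulerian (W n) = gamma_expansion (n - 1)%N gamma.
Proof.
elim/ltn_ind: n hn => n IHn n_gt0.
have [->|n_neq1] := eqVneq n 1; last first.
  apply: gamma_cone_W => // [m m_gt0 /IHn|m /hSimp[]] //; exact.
by rewrite two_sided_eulerian_W1; exact: gamma_cone1.
Qed.
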